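(* Let $n$ be a positive integer and let $\mathcal{D}=(\mathsf{D}_1,\dots,\mathsf{D}_m)$ be a family of $m=\left\lfloor \frac{6(n-1)}{5}\right\rfloor+1$ (not necessarily distinct as uncolored graphs) even cycles on a fixed vertex set of size $n$. Then $\mathcal{D}$ contains a rainbow even cycle.
   Context: A (colored) graph is a finite set $\mathsf G$ of pairs $(e,\alpha)$, where the $e$'s are pairwise distinct 2-element subsets $\{u,v\}$ (written $uv$) of a vertex set and $\alpha$ is a color (different edges may have the same color). $V(\mathsf G)$ is the set of vertices of its edges, $E(\mathsf G)$ the set of its underlying uncolored edges, $\chi(\mathsf G)$ the set of colors used. $\mathsf G$ is rainbow if $|\chi(\mathsf G)|=|\mathsf G|$. A cycle is a colored graph whose underlying uncolored edge set forms a cycle (length $\ge 3$); its length is its number of edges; it is even if its length is even. A family of cycles on a vertex set $V$ is a list $\mathcal D=(\mathsf D_1,\dots,\mathsf D_m)$ of cycles with $V(\mathsf D_i)\subseteq V$, where all edges of $\mathsf D_i$ receive one color $\alpha_i$ and $\alpha_1,\dots,\alpha_m$ are pairwise distinct (the underlying uncolored cycles may coincide). A subgraph of $\mathcal D$ is a (simple) colored graph $\mathsf G\subseteq \bigcup_i \mathsf D_i$, and $\mathcal D$ contains $\mathsf G$ if $\mathsf G$ is a subgraph of $\mathcal D$. Thus a rainbow even cycle in $\mathcal D$ is an even cycle formed by edges taken from pairwise distinct $\mathsf D_i$'s. *)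

(* Defs.v *)
From mathcomp Require Import all_boot.
Set Implicit Arguments. Unset Strict Implicit. Unset Printing Implicit Defensive.

(* Uncolored edges on vertex type V are 2-element sets {u,v} : {set V}.
   The cycle through the distinct vertices of s (in cyclic order) has edge set
   { {x, next s x} : x in s }. *)
Definition cycle_edges (V : finType) (s : seq V) : {set {set V}} :=
  [set [set x; next s x] | x in s].

Definition is_cycle (V : finType) (E : {set {set V}}) : Prop :=
  exists s : seq V, [/\ uniq s, 3 <= size s & E = cycle_edges s].

Definition is_even_cycle (V : finType) (E : {set {set V}}) : Prop :=
  is_cycle E /\ ~~ odd #|E|.

(* A family D of m cycles, D i having color i (so colors are pairwise distinct),
   contains a rainbow even cycle: an even cycle C together with a coloring
   f of its edges such that each edge e of C lies in D (f e) and the colors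
   of distinct edges of C are distinct. *)
Definition has_rainbow_even_cycle (V : finType) (m : nat)
    (D : 'I_m -> {set {set V}}) : Prop :=
  exists (C : {set {set V}}) (f : {set V} -> 'I_m),
    [/\ is_even_cycle C, {in C &, injective f} & forall e, e \in C -> e \in D (f e)].

(* Main.v *)
Require Import Defs.
From mathcomp Require Import all_boot.
From mathcomp Require Import zify.
From Stdlib Require Import Classical_Prop.

Set Implicit Arguments.
Unset Strict Implicit.
Unset Printing Implicit Defensive.

(* Suppose there is no rainbow even cycle and take a maximum rainbow forest T.
   For a colour i not used by T, an edge of D_i outside T must join two vertices
   of the same class of the bipartition of T, for otherwise it closes a rainbow
   even cycle with a path of T. Since D_i is even and meets every cut in an even
   number of edges, this forces the fundamental cycles of two unused colours to be
   edge-disjoint. Exchanging edges along paths of the exchange digraph, the sets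
   of colours reachable from distinct unused colours are disjoint as well. The
   set J reachable from i is tight: its cycles live on a vertex set of size at
   most |J|. Four 4-cycles on 4 vertices, or five on 5 vertices, always contain
   a rainbow 4-cycle, so |J| >= 6. Hence 6 (m - |T|) <= m while |T| <= n - 1.

   Forests are handled as independent sets over F_2: a vertex set, seen as
   a boolean function, is a linear form on edges ([crosses]). *)

(** * Cuts over F_2 and their parity on cycles *)

Section Cuts.
Variable V : finType.
Implicit Types (x y z : V -> bool) (e : {set V}) (s : seq V).

Definition crosses x e : bool := \big[addb/false]_(v in e) x v.

Lemma crosses_pair x u v : u != v -> crosses x [set u; v] = x u (+) x v.
Proof. by move=> uv; rewrite /crosses big_setU1 ?inE //= big_set1. Qed.

Lemma crosses_add x y e :
  crosses (fun v => x v (+) y v) e = crosses x e (+) crosses y e.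
Proof. exact: big_split. Qed.

Lemma crosses_scale b x e : crosses (fun v => b && x v) e = b && crosses x e.
Proof. by rewrite /crosses big_distrr. Qed.

Lemma crosses_sum (I : finType) (A : {pred I}) (F : I -> V -> bool) e :
  crosses (fun v => \big[addb/false]_(i in A) F i v) e =
  \big[addb/false]_(i in A) crosses (F i) e.
Proof. exact: exchange_big. Qed.

Lemma eq_crosses x y e : {in e, x =1 y} -> crosses x e = crosses y e.
Proof. by move=> xy; apply: eq_bigr. Qed.

Lemma addb_sum_odd (I : finType) (A : {set I}) :
  \big[addb/false]_(i in A) true = odd #|A|.
Proof.
rewrite big_const; elim: #|A| => //= k ->.
Qed.

Lemma addb_sum_other (I : finType) (A : {set I}) (F : pred I) i :
  \big[addb/false]_(j in A) F j = false -> i \in A -> F i ->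
  exists j, [/\ j \in A, j != i & F j].
Proof.
move=> sum0 iA Fi.
case: (pickP (fun j => [&& j \in A, j != i & F j])) => [j /and3P[]|none].
  by exists j.
move: sum0; rewrite (bigD1 i) //= Fi big1 // => j /andP[jA ji].
by have := none j; rewrite jA ji.
Qed.

Lemma next_neq s v : uniq s -> 1 < size s -> v \in s -> next s v != v.
Proof.
case: s => [//|a s] us s1 vs; rewrite next_nth vs.
have := vs; rewrite -index_mem; set i := index v _ => ilt.
have Ev : v = nth a (a :: s) i by rewrite nth_index.
have [lt|ge] := ltnP i (size s).
  rewrite [X in _ != X]Ev -[nth a s i]/(nth a (a :: s) i.+1) nth_uniq //; lia.
rewrite nth_default // [X in _ != X]Ev -[X in X != _]/(nth a (a :: s) 0) nth_uniq //=.
by move: s1 => /=; lia.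
Qed.

Definition cyc_succ k i := if i.+1 == k then 0 else i.+1.

Lemma index_next s v : uniq s -> v \in s ->
  index (next s v) s = cyc_succ (size s) (index v s).
Proof.
case: s => [//|a s] us vs; rewrite next_nth vs /cyc_succ.
have := vs; rewrite -index_mem; set i := index v _ => ilt.
have [lt|ge] := ltnP i (size s).
  rewrite -[nth a s i]/(nth a (a :: s) i.+1) index_uniq //=.
  by case: eqP => //; lia.
rewrite nth_default //= eqxx; case: eqP => //; move: ilt => /=; lia.
Qed.

(** Otherwise two vertices would each succeed the other, which forces length 2. *)
Lemma cycle_edge_inj s : uniq s -> 2 < size s ->
  {in s &, injective (fun v => [set v; next s v])}.
Proof.
move=> us s3 u v us' vs' /= E.
have uin : u \in [set v; next s v] by rewrite -E !inE eqxx.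
have vin : v \in [set u; next s u] by rewrite E !inE eqxx.
case/set2P: uin => // uE; case/set2P: vin => // vE.
have := index_next us us'; rewrite -vE => iv.
have := index_next us vs'; rewrite -uE => iu.
move: iv iu (us'); rewrite -index_mem /cyc_succ.
by case: eqP; case: eqP; lia.
Qed.

Lemma mem_cycle_edges s e :
  reflect (exists2 v, v \in s & e = [set v; next s v]) (e \in cycle_edges s).
Proof. exact: imsetP. Qed.

Lemma big_cycle_edges s (F : {set V} -> bool) : uniq s -> 2 < size s ->
  \big[addb/false]_(e in cycle_edges s) F e =
  \big[addb/false]_(v <- s) F [set v; next s v].
Proof.
move=> us s3; rewrite /cycle_edges big_imset /=; last exact: cycle_edge_inj.
by rewrite big_uniq.
Qed.

Lemma card_cycle_edges s : uniq s -> 2 < size s -> #|cycle_edges s| = size s.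
Proof.
move=> us s3; rewrite card_in_imset; last exact: cycle_edge_inj.
exact/card_uniqP.
Qed.

(** Every vertex contributes twice to the sum, because [next s] permutes [s]. *)
Lemma cycle_crosses_even s x : uniq s -> 2 < size s ->
  \big[addb/false]_(e in cycle_edges s) crosses x e = false.
Proof.
move=> us s3; rewrite big_cycle_edges //.
have -> : \big[addb/false]_(v <- s) crosses x [set v; next s v] =
          \big[addb/false]_(v <- s) (x v (+) x (next s v)).
  apply: eq_big_seq => v vs; rewrite crosses_pair // eq_sym next_neq //; lia.
rewrite big_split /= -(big_map (next s) xpredT x).
have sP : perm_eq (map (next s) s) s.
  apply: uniq_perm => //.
    by rewrite map_inj_uniq //; exact: can_inj (prev_next us).
  move=> v; apply/mapP/idP => [[u us' ->]|vs]; first by rewrite mem_next.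
  by exists (prev s v); rewrite ?mem_prev ?next_prev.
by rewrite (perm_big _ sP) /= addbb.
Qed.

Lemma cycle_edge_pair E e : is_cycle E -> e \in E ->
  exists u v, u != v /\ e = [set u; v].
Proof.
case=> s [us s3 ->] /mem_cycle_edges[v vs ->].
by exists v, (next s v); split=> //; rewrite eq_sym next_neq //; lia.
Qed.

Lemma is_cycle_crosses_even E x : is_cycle E ->
  \big[addb/false]_(e in E) crosses x e = false.
Proof. by case=> s [us s3 ->]; exact: cycle_crosses_even. Qed.

Lemma cycle_crosses_again E x e : is_cycle E -> e \in E -> crosses x e ->
  exists e', [/\ e' \in E, e' != e & crosses x e'].
Proof. by move=> /is_cycle_crosses_even cE; exact: addb_sum_other. Qed.

Lemma even_cycle_noncrossing_again E x e : is_even_cycle E -> e \in E ->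
  ~~ crosses x e -> exists e', [/\ e' \in E, e' != e & ~~ crosses x e'].
Proof.
case=> cE oE; apply: addb_sum_other.
(* Non-crossing is [true (+) crosses x e]; the two sums are the parities of [#|E|] and of a cut. *)
under eq_bigr do rewrite -addTb.
by rewrite big_split /= addb_sum_odd (negbTE oE) is_cycle_crosses_even.
Qed.

Lemma cycle_two_edge_cut E e e' : is_cycle E -> e \in E -> e' \in E -> e != e' ->
  exists2 x, crosses x e & {in E, forall f, crosses x f -> f = e \/ f = e'}.
Proof.
case=> s [us s3 ->] /mem_cycle_edges[u us' ->] /mem_cycle_edges[v vs' ->] uv.
(* The arc between the two edges, as a sum of two initial segments of [s]. Each segment is cut at
   its own edge and at the wrap-around edge, and the latter cancels. *)
pose x w := (index w s <= index u s) (+) (index w s <= index v s).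
have xP w : w \in s -> crosses x [set w; next s w] = (w == u) (+) (w == v).
  move=> ws; rewrite crosses_pair; last by rewrite eq_sym next_neq //; lia.
  rewrite /x index_next //.
  have iE a : a \in s -> (w == a) = (index w s == index a s).
    move=> as'; apply/eqP/eqP => [->//|Ei].
    by rewrite -(nth_index w ws) -(nth_index w as') Ei.
  rewrite !iE // /cyc_succ.
  move: us' vs' ws; rewrite -!index_mem; case: ifP => wE;
  case: (ltngtP (index w s) (index u s)); case: (ltngtP (index w s) (index v s));
  rewrite //=; lia.
exists x.
  have uv' : u != v by apply: contra_neq uv => ->.
  by rewrite xP // eqxx (negbTE uv').
move=> f /mem_cycle_edges[w ws ->]; rewrite xP //.
by case: eqP => [->|_]; [left | case: eqP => [->|]; [right|]].
Qed.

Lemma cycle_connected E x u v : is_cycle E ->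
  {in E, forall e, ~~ crosses x e} -> u \in cover E -> v \in cover E -> x u = x v.
Proof.
case=> s [us s3 ->] x0.
have covs w : w \in cover (cycle_edges s) -> w \in s.
  case/bigcupP=> e /mem_cycle_edges[a as' ->]; rewrite !inE.
  by case/orP=> /eqP ->; rewrite ?mem_next.
have xnext w : w \in s -> x (next s w) = x w.
  move=> ws; have : ~~ crosses x [set w; next s w].
    by apply: x0; apply/mem_cycle_edges; exists w.
  rewrite crosses_pair; last by rewrite eq_sym next_neq //; lia.
  by case: (x w); case: (x _).
move=> /covs us' /covs vs'.
have [a aP] : exists a, {in s, forall w, x w = a}.
  case: s us s3 xnext {x0 covs us' vs'} => [//|b s] us s3 xnext.
  exists (x b) => w ws; rewrite -(nth_index b ws).
  have : index w (b :: s) < size (b :: s) by rewrite index_mem.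
  elim: (index _ _) => [//|i IH] lt.
  have lt' := ltnW lt; rewrite -IH // -[RHS]xnext ?mem_nth //.
  by rewrite next_nth mem_nth // index_uniq.
by rewrite !aP.
Qed.

End Cuts.

(** * Rainbow forests, spans and edge exchanges *)

Section Family.
Variables (V : finType) (m : nat) (D : 'I_m -> {set {set V}}).
Implicit Types (K : {set 'I_m}) (t : 'I_m -> {set V}) (x : 'I_m -> V -> bool).
Implicit Types (i j k l : 'I_m) (e f g h : {set V}) (y : V -> bool).

Lemma rainbow_even_cycle_of_seq (s : seq V) (col : V -> 'I_m) :
  uniq s -> 2 < size s -> ~~ odd (size s) -> {in s &, injective col} ->
  {in s, forall v, [set v; next s v] \in D (col v)} ->
  has_rainbow_even_cycle D.
Proof.
move=> us s3 so colI colD.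
case: s us s3 so colI colD => [//|a s] us s3 so colI colD.
set r := a :: s in us s3 so colI colD.
(* [F] recovers the vertex at which an edge starts, turning the vertex colouring [col] into an edge
   colouring; the default [a] never occurs on edges of the cycle. *)
pose F e := odflt a [pick v in r | [set v; next r v] == e].
have FE v : v \in r -> F [set v; next r v] = v.
  rewrite /F => vr; case: pickP => [w /andP[wr /eqP]|].
    exact: cycle_edge_inj.
  by move/(_ v); rewrite vr eqxx.
exists (cycle_edges r), (col \o F); split.
- by split; [exists r | rewrite card_cycle_edges].
- move=> e e' /mem_cycle_edges[v vr ->] /mem_cycle_edges[w wr ->] /=.
  by rewrite !FE // => /colI ->.
- by move=> e /mem_cycle_edges[v vr ->] /=; rewrite FE // colD.
Qed.

(* A rainbow forest [t] on the colours [K]; acyclicity is witnessed over F_2 by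
   cuts [x] dual to its edges. *)
Definition rainbow_forest K t x :=
  {in K, forall j, t j \in D j} /\
  {in K &, forall j l, crosses (x j) (t l) = (j == l)}.

Definition max_rainbow_forest K t x :=
  rainbow_forest K t x /\
  forall K' t' x', rainbow_forest K' t' x' -> #|K'| <= #|K|.

(** Membership of [e] in the F_2-span of the forest edges, expressed by duality with cuts. *)
Definition spanned K t e :=
  forall y, {in K, forall l, ~~ crosses y (t l)} -> ~~ crosses y e.

(** Expansion in the dual basis: the [l] with [crosses (x l) e] are the colours of the forest path
    joining the ends of [e]. Subtracting from [y] its projection on the dual cuts leaves a cut that
    misses the forest, hence misses [e]. *)
Lemma spanned_crosses K t x e y : rainbow_forest K t x -> spanned K t e ->
  crosses y e = \big[addb/false]_(l in K) (crosses (x l) e && crosses y (t l)).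
Proof.
move=> [_ dual] sp.
pose y' v := y v (+) \big[addb/false]_(l in K) (crosses y (t l) && x l v).
have y'E f : crosses y' f =
    crosses y f (+) \big[addb/false]_(l in K) (crosses y (t l) && crosses (x l) f).
  rewrite crosses_add crosses_sum; congr (_ (+) _).
  by apply: eq_bigr => l _; rewrite crosses_scale.
have := sp y'; rewrite y'E => /(_ _)/negbTE.
move=> H; have {}H : crosses y e (+)
    \big[addb/false]_(l in K) (crosses y (t l) && crosses (x l) e) = false.
  apply: H => l lK; rewrite y'E (bigD1 l) //= dual // eqxx andbT.
  rewrite big1 ?addbF ?addbb // => j /andP[jK jl].
  by rewrite dual // (negbTE jl) andbF.
under eq_bigr do rewrite andbC.
by move: H; case: (crosses y e); case: (\big[_/_]_(_ in _) _).
Qed.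

(** The sum of the dual cuts serves as the bipartition of the forest. *)
Definition parity K x v := \big[addb/false]_(l in K) x l v.

Lemma crosses_parity K t x l : rainbow_forest K t x -> l \in K ->
  crosses (parity K x) (t l).
Proof.
move=> [_ dual] lK; rewrite /parity crosses_sum (bigD1 l) //= dual // eqxx.
by rewrite big1 // => j /andP[jK jl]; rewrite dual // (negbTE jl).
Qed.

(** The component of [u], taken as a cut, is crossed by no forest edge, hence not by the edge
    [uv]. *)
Lemma spanned_connect K t u v : u != v ->
  {in K, forall l, exists a b, a != b /\ t l = [set a; b]} ->
  spanned K t [set u; v] ->
  connect (fun a b => [exists l in K, t l == [set a; b]]) u v.
Proof.
move=> uv tP sp; set r := (fun _ _ => _).
have rsym : symmetric r.
  by move=> a b; apply: eq_existsb => l; rewrite setUC.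
have := sp (connect r u); rewrite crosses_pair // connect0 addTb negbK; apply.
move=> l lK; have [a [b [ab tE]]] := tP l lK.
rewrite tE crosses_pair // negb_add; apply/eqP.
have rab : r a b by apply/existsP; exists l; rewrite lK tE eqxx.
apply: same_connect_r; first exact: sym_connect_sym.
exact: connect1.
Qed.

Hypothesis D_even : forall i, is_even_cycle (D i).
Hypothesis no_rainbow : ~ has_rainbow_even_cycle D.

Lemma D_cycle i : is_cycle (D i). Proof. by case: (D_even i). Qed.

(* Otherwise the path of the forest joining the ends of [g] closes up with [g]
   to a rainbow even cycle. *)
Lemma chord_same_side K t x k g (p : V -> bool) : rainbow_forest K t x -> k \notin K ->
  g \in D k -> spanned K t g -> {in K, forall l, g != t l} ->
  {in K, forall l, crosses p (t l)} -> ~~ crosses p g.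
Proof.
move=> RF kK gD sp gt pT; apply/negP => pg; apply: no_rainbow.
have [tD dual] := RF.
have [u [v [uv gE]]] := cycle_edge_pair (D_cycle k) gD.
have tP : {in K, forall l, exists a b, a != b /\ t l = [set a; b]}.
  by move=> l lK; exact: cycle_edge_pair (D_cycle l) (tD l lK).
rewrite gE in sp; have := spanned_connect uv tP sp; set r := (fun _ _ => _).
case/connectP=> q0 /shortenP[q rq uq _] vE {q0}.
pose r' a b := r a b || (g == [set a; b]).
have cyc : cycle r' (u :: q).
  rewrite /= rcons_path -vE; apply/andP; split.
    by apply: sub_path rq => a b rab; rewrite /r' rab.
  by rewrite /r' gE setUC eqxx orbT.
have size3 : 2 < size (u :: q).
  case: q rq uq vE {cyc} => [|a [|b q]] //=; first by move=> _ _ E; rewrite E eqxx in uv.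
  rewrite andbT => /existsP[l /andP[lK /eqP tE]] _ vE.
  by have := gt l lK; rewrite tE gE vE eqxx.
(* The default [k] is the colour of the closing edge [g]. *)
pose col a := odflt k [pick l in K | t l == [set a; next (u :: q) a]].
have colP a : a \in u :: q ->
    (col a \in K /\ t (col a) = [set a; next (u :: q) a]) \/
    (col a = k /\ g = [set a; next (u :: q) a]).
  move=> aq; rewrite /col; case: pickP => [l /andP[lK /eqP]|none]; first by left.
  right; split=> //; have /orP[/existsP[l]|/eqP//] := next_cycle cyc aq.
  by rewrite none.
apply: (@rainbow_even_cycle_of_seq (u :: q) col) => //.
(* All edges of this cycle cross [p], and a cycle meets a cut evenly, so its length is even. *)
- rewrite -card_cycle_edges // -addb_sum_odd.
  apply/negbT; rewrite -[RHS](cycle_crosses_even p uq size3); apply: eq_bigr => e.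
  by move=> /mem_cycle_edges[a /colP[[aK <-]|[_ <-]] ->]; rewrite ?pT.
- move=> a b aq bq cab; apply: (cycle_edge_inj uq size3 aq bq) => /=.
  have [[aK <-]|[ak <-]] := colP a aq; have [[bK <-]|[bk <-]] := colP b bq => //.
  + by rewrite cab.
  + by rewrite cab bk (negbTE kK) in aK.
  + by rewrite -cab ak (negbTE kK) in bK.
- move=> a /colP[[aK <-]|[-> <-]] //; exact: tD.
Qed.

Definition swap_set K j i := i |: K :\ j.
Definition swap_edge t i f l := if l == i then f else t l.
(** A pivot step: [x j] becomes dual to the new edge [f], and adding [x j] where needed makes the
    other cuts vanish on [f]. *)
Definition swap_cut x j i f l v :=
  if l == i then x j v else x l v (+) (crosses (x l) f && x j v).

Lemma crosses_swap_cut x j i f l e : crosses (swap_cut x j i f l) e =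
  if l == i then crosses (x j) e
  else crosses (x l) e (+) (crosses (x l) f && crosses (x j) e).
Proof.
rewrite /swap_cut; case: eqP => // _.
by rewrite crosses_add crosses_scale.
Qed.

Lemma rainbow_forest_swap K t x i j f : rainbow_forest K t x -> i \notin K ->
  j \in K -> f \in D i -> crosses (x j) f ->
  rainbow_forest (swap_set K j i) (swap_edge t i f) (swap_cut x j i f).
Proof.
move=> [tD dual] iK jK fD jf; split=> [l|l l'].
  rewrite /swap_edge !inE; case: eqP => [->//|_] /= /andP[_]; exact: tD.
rewrite crosses_swap_cut /swap_edge !inE.
case: (eqVneq l i) => [->|li] /=; case: (eqVneq l' i) => [->|l'i] //=.
- by move=> _ /andP[l'j l'K]; rewrite dual // eq_sym (negbTE l'j).
- by move=> /andP[lj lK] _; rewrite jf andbT addbb (negbTE li).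
- move=> /andP[lj lK] /andP[l'j l'K]; rewrite !dual // [j == l']eq_sym.
  by rewrite (negbTE l'j) andbF addbF.
Qed.

Lemma card_swap_set K i j : i \notin K -> j \in K -> #|swap_set K j i| = #|K|.
Proof.
by move=> iK jK; rewrite cardsU1 !inE (negbTE iK) andbF (cardsD1 j K) jK.
Qed.

Lemma max_rainbow_forest_swap K t x i j f : max_rainbow_forest K t x ->
  i \notin K -> j \in K -> f \in D i -> crosses (x j) f ->
  max_rainbow_forest (swap_set K j i) (swap_edge t i f) (swap_cut x j i f).
Proof.
move=> [RF mx] iK jK fD jf; split; first exact: rainbow_forest_swap.
by rewrite card_swap_set.
Qed.

(** A cut [y] crossed by [h] but by no forest edge would be dual to [h]; once the other cuts are
    corrected by [y], the forest gains colour [i], against maximality. *)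
Lemma unused_spanned K t x i h : max_rainbow_forest K t x -> i \notin K ->
  h \in D i -> spanned K t h.
Proof.
move=> [[tD dual] mx] iK hD y y0; apply/negP => yh.
pose x' l v := if l == i then y v else x l v (+) (crosses (x l) h && y v).
have := mx (i |: K) (swap_edge t i h) x'.
rewrite cardsU1 iK add1n ltnn => contra; suff: false by [].
apply: contra; split=> [l|l l'].
  by rewrite !inE /swap_edge; case: eqP => [->//|_] /=; exact: tD.
have x'E e : crosses (x' l) e = if l == i then crosses y e
    else crosses (x l) e (+) (crosses (x l) h && crosses y e).
  by rewrite /x'; case: eqP => // _; rewrite crosses_add crosses_scale.
rewrite x'E /swap_edge !inE.
case: (eqVneq l i) => [->|li] /=; case: (eqVneq l' i) => [->|l'i] //=.
- by move=> _ l'K; rewrite (negbTE (y0 _ _)).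
- by move=> lK _; rewrite yh andbT addbb (negbTE li).
- by move=> lK l'K; rewrite dual // (negbTE (y0 _ _)) // andbF addbF.
Qed.

Lemma unused_edge K t x k h (p : V -> bool) : max_rainbow_forest K t x -> k \notin K ->
  h \in D k -> {in K, forall l, crosses p (t l)} -> crosses p h ->
  exists2 l, l \in K & h = t l.
Proof.
move=> mF kK hD pT ph.
case: (pickP [pred l in K | h == t l]) => [l /andP[lK /eqP]|none]; first by exists l.
have sp := unused_spanned mF kK hD.
have ht : {in K, forall l, h != t l}.
  by move=> l lK; have := none l; rewrite /= lK => /negbT.
by have := chord_same_side mF.1 kK hD sp ht pT; rewrite ph.
Qed.

(** If [h] crosses the bipartition, it is a forest edge. If not, it crosses the bipartition [p'] of
    the forest in which [f] replaces [t j], so it is an edge of that forest. *)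
Lemma unused_cut_edges K t x i j k f : max_rainbow_forest K t x ->
  i \notin K -> k \notin K -> i != k -> j \in K ->
  f \in D i -> {in K, forall l, f != t l} -> crosses (x j) f ->
  {in D k, forall h, crosses (x j) h -> h = t j \/ h = f}.
Proof.
move=> mF iK kK ik jK fD ft jf h hD jh.
have RF := mF.1; have [tD dual] := RF.
have pT l : l \in K -> crosses (parity K x) (t l) by exact: crosses_parity.
have tj l : l \in K -> h = t l -> h = t j.
  by move=> lK hE; move: jh; rewrite hE dual // => /eqP ->.
have [ph|ph] := boolP (crosses (parity K x) h).
  by have [l lK hE] := unused_edge mF kK hD pT ph; left; exact: tj hE.
have pf : ~~ crosses (parity K x) f.
  exact: chord_same_side RF iK fD (unused_spanned mF iK fD) ft pT.
have mF' := max_rainbow_forest_swap mF iK jK fD jf.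
pose p' v := parity K x v (+) x j v.
have p'T : {in swap_set K j i, forall l, crosses p' (swap_edge t i f l)}.
  move=> l; rewrite !inE /swap_edge /p' crosses_add.
  case: eqP => [_ _|_ /= /andP[lj lK]]; first by rewrite jf (negbTE pf).
  by rewrite pT // dual // eq_sym (negbTE lj).
have kK' : k \notin swap_set K j i.
  by rewrite !inE negb_or eq_sym ik /= (negbTE kK) andbF.
have p'h : crosses p' h by rewrite crosses_add jh (negbTE ph).
have [l] := unused_edge mF' kK' hD p'T p'h.
rewrite !inE /swap_edge; case: eqP => [_ _ ->|_ /= /andP[_ lK] hE]; first by right.
by left; exact: tj hE.
Qed.

(** * The exchange digraph on colours *)

(** An arc from [a] to [b] says that the forest edge of colour [b] lies on the fundamental cycle of
    some edge of [D a], or is that edge itself. *)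
Definition exch K x a b := (b \in K) && [exists g in D a, crosses (x b) g].

(** A common [j] forces into [D i] both a chord [f] and its whole forest path. These form an odd
    cycle, because the ends of [f] are on the same side, while [D i] is a single even cycle. *)
Lemma exch_disjoint K t x i k j : max_rainbow_forest K t x ->
  i \notin K -> k \notin K -> i != k -> exch K x i j -> exch K x k j -> False.
Proof.
move=> mF iK kK ik /andP[jK /existsP[f0 /andP[f0D jf0]]].
case/andP=> _ /existsP[g /andP[gD jg]].
have RF := mF.1; have [tD dual] := RF.
(* If the given edge is [t j] itself, [D i] crosses the cut [x j] in a second edge, which cannot
   belong to the forest. *)
have [f [fD ft jf]] :
    exists f, [/\ f \in D i, {in K, forall l, f != t l} & crosses (x j) f].
  have [f1 [f1D f10 jf1]] := cycle_crosses_again (D_cycle i) f0D jf0.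
  have [E|N] := eqVneq f0 (t j).
    exists f1; split=> // l lK; apply: contraTneq jf1 => f1E.
    by rewrite f1E dual //; apply: contraNneq f10 => jl; rewrite f1E E jl.
  exists f0; split=> // l lK; apply: contraTneq jf0 => f0E.
  by rewrite f0E dual //; apply: contraNneq N => jl; rewrite f0E jl.
(* [D b] crosses the cut [x c] only in [t c] and [f], and an even number of times, so it contains
   both as soon as it contains one. *)
have both a b c : a \notin K -> b \notin K -> a != b -> c \in K -> f \in D a ->
    crosses (x c) f -> (exists2 h, h \in D b & crosses (x c) h) ->
    f \in D b /\ t c \in D b.
  move=> aK bK ab cK fa cf [h hD ch].
  have cutE := unused_cut_edges mF aK bK ab cK fa ft cf.
  have [h' [h'D h'h ch']] := cycle_crosses_again (D_cycle b) hD ch.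
  have [E|E] := cutE h hD ch; have [E'|E'] := cutE h' h'D ch';
    by rewrite -?E -?E' //; rewrite E E' eqxx in h'h.
have [fk _] := both i k j iK kK ik jK fD jf (ex_intro2 _ _ g gD jg).
have tDi b : b \in K -> crosses (x b) f -> t b \in D i.
  move=> bK bf; rewrite eq_sym in ik.
  by have [] := both k i b kK iK ik bK fk bf (ex_intro2 _ _ f fD bf).
have pT l : l \in K -> crosses (parity K x) (t l) by exact: crosses_parity.
have spf := unused_spanned mF iK fD.
have pf := chord_same_side RF iK fD spf ft pT.
(* The cut [y] meets [D i] only in [f] and [f']. It misses the forest path of [f], whose edges lie
   in [D i] and, unlike [f'], cross the bipartition; yet it is crossed by [f]. *)
have [f' [f'D f'f pf']] := even_cycle_noncrossing_again (D_even i) fD pf.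
rewrite eq_sym in f'f.
have [y yf yD] := cycle_two_edge_cut (D_cycle i) fD f'D f'f.
move: yf; rewrite (spanned_crosses y RF spf) big1 // => l lK.
case lf: (crosses (x l) f) => //=; apply/negP => yl.
case: (yD _ (tDi l lK lf) yl) => E; first by have := ft l lK; rewrite E eqxx.
by have := pT l lK; rewrite E (negbTE pf').
Qed.

(* Exchanging along the first arc of a path keeps the later arcs, unless
   a shortcut from its origin existed. *)
Lemma path_swap K x i j f a q : f \in D i -> j \in K -> i \notin K ->
  crosses (x j) f -> {in q, forall b, ~~ exch K x i b} ->
  path (exch K x) a q -> path (exch (swap_set K j i) (swap_cut x j i f)) a q.
Proof.
move=> fD jK iK jf; elim: q a => //= b q IH a nq /andP[/andP[bK ab] pq].
have := nq b (mem_head _ _); rewrite /exch bK /= => nb.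
have bf : ~~ crosses (x b) f.
  by apply: contra nb => bf; apply/existsP; exists f; rewrite fD.
rewrite IH // ?andbT; last by move=> c cq; apply: nq; rewrite inE cq orbT.
have bj : b != j by apply: contraNneq bf => ->.
have bi : b != i by apply: contraNneq iK => <-.
rewrite !inE bK bj orbT /=; case/existsP: ab => g /andP[gD bg].
by apply/existsP; exists g; rewrite gD crosses_swap_cut (negbTE bi) (negbTE bf) bg.
Qed.

Lemma path_first_hit (T : eqType) (r : rel T) (P : pred T) a q :
  path r a q -> has P q ->
  exists b q1 q2, [/\ P b, q = q1 ++ b :: q2, path r a (rcons q1 b) & path r b q2].
Proof.
move=> pq /hasP[b bq Pb]; exists b.
case/splitPr: bq pq => q1 q2; rewrite cat_path /= => /and3P[p1 lb p2].
by exists q1, q2; split=> //; rewrite rcons_path p1.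
Qed.

Lemma paths_disjoint K t x i k (p q : seq 'I_m) : max_rainbow_forest K t x ->
  i \notin K -> k \notin K -> i != k -> p != [::] -> q != [::] ->
  path (exch K x) i p -> path (exch K x) k q -> last i p = last k q -> False.
Proof.
have [N] := ubnP (size p + size q).
elim: N K t x i k p q => // N IH K t x i k p q ltN mF iK kK ik p0 q0 pp pq pqE.
(* Two single arcs with a common end are the case of [exch_disjoint]. *)
wlog p2 : i k p q ltN iK kK ik p0 q0 pp pq pqE / 1 < size p.
  move=> W; have [lt|le] := ltnP 1 (size p); first exact: (W i k p q).
  have [lt|le'] := ltnP 1 (size q).
    by apply: (W k i q p) => //; rewrite ?[size q + _]addnC // eq_sym.
  case: p p0 le pp pqE {ltN W} => [//|j [|//]] _ _ /=; rewrite andbT => ij jE.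
  case: q q0 le' pq jE => [//|l [|//]] _ _ /=; rewrite andbT => kl jE.
  by rewrite jE in ij; exact: exch_disjoint mF iK kK ik ij kl.
case: p p0 p2 pp pqE ltN => [//|j p] _ p1 /= /andP[ij pp] pqE ltN.
have [hit|nohit] := boolP (has (exch K x i) p).
  have [b [p1' [p2 [ib pE _ pb]]]] := path_first_hit pp hit.
  apply: (IH K t x i k (b :: p2) q) => //=; last by rewrite -pqE pE last_cat.
  - by move: ltN; rewrite pE size_cat /=; lia.
  - by rewrite ib.
have [hit|nohit'] := boolP (has (exch K x i) q).
  have [b [q1 [q2 [ib qE pb _]]]] := path_first_hit pq hit.
  apply: (IH K t x i k [:: b] (rcons q1 b)) => //=.
  - by move: ltN p1; rewrite qE /= size_cat size_rcons /=; lia.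
  - by rewrite -size_eq0 size_rcons.
  - by rewrite ib.
  - by rewrite last_rcons.
have /andP[jK /existsP[f /andP[fD jf]]] := ij.
have ok r : ~~ has (exch K x i) r -> {in r, forall b, ~~ exch K x i b}.
  by move/hasPn.
apply: (IH _ _ _ j k p q _ (max_rainbow_forest_swap mF iK jK fD jf)) => //.
- by rewrite !inE negb_or eqxx /= andbT; apply: contraNneq iK => <-.
- by rewrite !inE negb_or eq_sym ik (negbTE kK) andbF.
- by apply: contraNneq kK => <-.
- by rewrite -size_eq0; move: p1 => /=; lia.
- exact: path_swap (ok _ nohit) pp.
- exact: path_swap (ok _ nohit') pq.
Qed.

(** The same induction on paths. An exchange stays inside the span of the old forest, so being
    spanned by the new forest suffices. *)
Lemma reachable_spanned K t x i (p : seq 'I_m) h :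
  max_rainbow_forest K t x -> i \notin K ->
  path (exch K x) i p -> h \in D (last i p) -> spanned K t h.
Proof.
have [N] := ubnP (size p).
elim: N K t x i p => // N IH K t x i [|j p] ltN mF iK /=.
  by move=> _ hD; exact: unused_spanned mF iK hD.
move=> /andP[ij pp] hD.
have [hit|nohit] := boolP (has (exch K x i) p).
  have [b [p1 [p2 [ib pE _ pb]]]] := path_first_hit pp hit.
  apply: (IH K t x i (b :: p2)) => //=.
  - by move: ltN; rewrite /= pE size_cat /=; lia.
  - by rewrite ib.
  - by move: hD; rewrite pE last_cat.
have /andP[jK /existsP[f /andP[fD jf]]] := ij.
move=> y y0; apply: (IH _ _ _ j p _ (max_rainbow_forest_swap mF iK jK fD jf)) => //.
- by rewrite !inE negb_or eqxx /= andbT; apply: contraNneq iK => <-.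
- by apply: path_swap pp => // b bp; exact: (hasPn nohit).
- move=> l; rewrite !inE /swap_edge; case: eqP => [_ _|_ /= /andP[_]]; last exact: y0.
  exact: unused_spanned mF iK fD y y0.
Qed.

Definition reach K x i := [set j | connect (exch K x) i j].

Lemma reach_disjoint K t x i k : max_rainbow_forest K t x ->
  i \notin K -> k \notin K -> i != k -> [disjoint reach K x i & reach K x k].
Proof.
move=> mF iK kK ik; rewrite -setI_eq0; apply/eqP/setP => l; rewrite !inE.
apply/negP => /andP[/connectP[p pp lE] /connectP[q pq lE']].
have lastK a r : r != [::] -> path (exch K x) a r -> last a r \in K.
  case/lastP: r => [//|r b] _; rewrite rcons_path last_rcons.
  by case/andP=> _ /andP[].
have [E|p0] := eqVneq p [::]; have [E'|q0] := eqVneq q [::].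
- by move: ik; rewrite -[i]/(last i [::]) -E -lE lE' E' eqxx.
- by move: (lastK _ _ q0 pq); rewrite -lE' lE E /= (negbTE iK).
- by move: (lastK _ _ p0 pp); rewrite -lE lE' E' /= (negbTE kK).
- by apply: (paths_disjoint mF iK kK ik p0 q0 pp pq); rewrite -lE.
Qed.

Lemma reach_used K x i j : j \in reach K x i -> j != i -> j \in K.
Proof.
rewrite inE => /connectP[p]; case/lastP: p => [_ -> /eqP//|p b].
by rewrite rcons_path last_rcons => /andP[_ /andP[bK _]] ->.
Qed.

Lemma reach_closed K x i j b h : j \in reach K x i -> h \in D j -> b \in K ->
  crosses (x b) h -> b \in reach K x i.
Proof.
rewrite !inE => ij hD bK bh; apply: connect_trans ij (connect1 _).
by rewrite /exch bK; apply/existsP; exists h; rewrite hD.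
Qed.

(** By closure under arcs, the forest path joining the ends of [h] uses only reachable colours. *)
Lemma reach_spanned K t x i j h : max_rainbow_forest K t x -> i \notin K ->
  j \in reach K x i -> h \in D j -> spanned (reach K x i :\ i) t h.
Proof.
move=> mF iK jR hD y y0.
have sp : spanned K t h.
  by have := jR; rewrite inE => /connectP[p pp jE]; rewrite jE in hD;
    exact: reachable_spanned mF iK pp hD.
rewrite (spanned_crosses y mF.1 sp) big1 // => l lK.
case lh: (crosses (x l) h) => //=; apply/negbTE/y0.
rewrite !inE; have := reach_closed jR hD lK lh; rewrite inE => ->.
by rewrite andbT; apply: contraNneq iK => <-.
Qed.

End Family.

(** * Exhaustive search among 4-cycles on four or five labels *)

Definition cyclic_pairs (T : Type) (q : seq T) := zip q (rot 1 q).

Definition joins (es : seq (nat * nat)) (e : nat * nat) :=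
  (e \in es) || ((e.2, e.1) \in es).

(** Backtracking search: [avail] holds the positions of the cycles not yet spent, so a success uses
    pairwise distinct colours. *)
Fixpoint assignable (cols : seq (seq (nat * nat))) es (avail : seq nat) :=
  if es is e :: es' then
    has (fun c => joins (nth [::] cols c) e && assignable cols es' (rem c avail)) avail
  else true.

Definition quads k : seq (seq nat) :=
  let prs := [seq (a, b) | a <- iota 0 k, b <- iota 0 k] in
  [seq q <- [seq [:: p.1; p.2; p'.1; p'.2] | p <- prs, p' <- prs] | uniq q].

(* Each 4-cycle is listed once: from its least vertex towards the smaller of the
   two neighbours. *)
Definition four_cycles k :=
  [seq q <- quads k | all (leq (nth 0 q 0)) q && (nth 0 q 1 < nth 0 q 3)].

Definition rainbow_four_cycle (C : seq (seq nat)) cols :=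
  has (fun q => assignable cols (cyclic_pairs q) (iota 0 (size cols))) C.

Definition four_cycles4 := Eval compute in four_cycles 4.
Definition four_cycles5 := Eval compute in four_cycles 5.
Definition edges4 := Eval compute in map (@cyclic_pairs nat) four_cycles4.
Definition edges5 := Eval compute in map (@cyclic_pairs nat) four_cycles5.
(** Relabelling the vertices lets the first cycle always be this one, so only the remaining cycles
    are enumerated. *)
Definition outer_edges := Eval compute in cyclic_pairs [:: 0; 1; 2; 3].

Lemma four_cycles_complete k q : k \in [:: 4; 5] -> q \in quads k ->
  exists2 c, c \in four_cycles k & all (joins (cyclic_pairs q)) (cyclic_pairs c).
Proof.
move=> kE qk; apply/hasP; move: q qk; apply/allP.
by move: kE; rewrite !inE => /orP[] /eqP ->; vm_compute.
Qed.

Lemma rainbow_four_cycle4 : all (fun a => all (fun b => all (fun c =>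
  rainbow_four_cycle four_cycles4 [:: outer_edges; a; b; c]) edges4) edges4) edges4.
Proof. by lazy. Qed.

(* Only 24 of the 15^3 triples need a fifth cycle. *)
Lemma rainbow_four_cycle5 : all (fun a => all (fun b => all (fun c =>
  rainbow_four_cycle four_cycles5 [:: outer_edges; a; b; c] ||
  all (fun d => rainbow_four_cycle four_cycles5 [:: outer_edges; a; b; c; d])
    edges5) edges5) edges5) edges5.
Proof. by lazy. Qed.

Lemma mem_quads k q :
  (q \in quads k) = [&& size q == 4, uniq q & all (fun a => a < k) q].
Proof.
rewrite mem_filter andbCA; congr (_ && _).
apply/allpairsP/andP => [[[[a b] [c d]]] /= [ab cd ->]|].
  case/allpairsP: ab => -[? ?] /= [ka kb [-> ->]].
  case/allpairsP: cd => -[? ?] /= [kc kd [-> ->]].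
  by move: ka kb kc kd; rewrite !mem_iota /= => -> -> -> ->.
case: q => [|a [|b [|c [|d [|? ?]]]]] []//= _ /and5P[ka kb kc kd _].
exists ((a, b), (c, d)); split=> //; apply/allpairsP.
  by exists (a, b); rewrite !mem_iota.
by exists (c, d); rewrite !mem_iota.
Qed.

Lemma assignableP cols es avail : uniq avail -> assignable cols es avail ->
  exists al : seq nat, [/\ size al = size es, uniq al, {subset al <= avail} &
    forall i, i < size es -> joins (nth [::] cols (nth 0 al i)) (nth (0, 0) es i)].
Proof.
elim: es avail => [|e es IH] avail ua /=; first by exists [::].
case/hasP=> c ca /andP[ce /(IH _ (rem_uniq c ua))[al [sal ual sub alP]]].
exists (c :: al); split=> /=; first by rewrite sal.
- rewrite ual andbT; apply/negP => /sub.
  by rewrite mem_rem_uniq // !inE eqxx.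
- by move=> d; rewrite inE => /predU1P[->//|/sub/mem_rem].
- by case.
Qed.

Lemma next_nth_rot (T : eqType) (x0 : T) (s : seq T) i : uniq s -> i < size s ->
  next s (nth x0 s i) = nth x0 (rot 1 s) i.
Proof.
case: s => [//|a s] us lt; rewrite next_nth mem_nth // index_uniq // rot1_cons.
rewrite nth_rcons; have := lt; rewrite /= ltnS leq_eqVlt => /predU1P[->|lti].
  by rewrite ltnn eqxx nth_default.
by rewrite lti; exact: set_nth_default.
Qed.

Section SmallFamilies.
Variables (V : finType) (m : nat) (D : 'I_m -> {set {set V}}) (w : nat -> V).

Definition realizes (es : seq (nat * nat)) j :=
  {in es, forall e, [set w e.1; w e.2] \in D j}.

Lemma realizes_joins es j e : realizes es j -> joins es e ->
  [set w e.1; w e.2] \in D j.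
Proof. by move=> R /orP[/R//|/R]; rewrite setUC. Qed.

(** Transports a computed assignment along [w]: a vertex receives the colour assigned to the edge
    towards its successor. *)
Lemma rainbow_of_realized k C cols js : {in iota 0 k &, injective w} ->
  {subset C <= quads k} -> uniq js -> size js = size cols ->
  (forall c i0, c < size cols -> realizes (nth [::] cols c) (nth i0 js c)) ->
  rainbow_four_cycle C cols -> has_rainbow_even_cycle D.
Proof.
move=> wI Ck ujs sjs R /hasP[q /Ck]; rewrite mem_quads => /and3P[/eqP sq uq /allP qk].
case/(assignableP (iota_uniq _ _)) => al [sal ual sub alP].
have sz : size (cyclic_pairs q) = 4 by rewrite size_zip size_rot sq.
(* A default colour exists: with [js] empty no position would be available for the four edges. *)
have j0 : 'I_m.
  case: js ujs sjs {R} => [_ /= E|j //].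
  have := sub (nth 0 al 0); rewrite mem_nth ?sal ?sz // -E /=.
  by move/(_ isT).
pose s := map w q.
have us : uniq s.
  rewrite map_inj_in_uniq // => a b /qk ak /qk bk; apply: wI.
    by rewrite mem_iota.
  by rewrite mem_iota.
have ss : size s = 4 by rewrite size_map.
have alt i : i < 4 -> nth 0 al i < size cols.
  move=> lt; have := sub (nth 0 al i).
  by rewrite mem_iota mem_nth ?sal ?sz // => /(_ isT).
pose col v := nth j0 js (nth 0 al (index v s)).
apply: (@rainbow_even_cycle_of_seq _ _ D s col) => //; rewrite ?ss //.
- move=> a b as' bs' /= /eqP; have := as'; have := bs'.
  rewrite -!index_mem ss => lb la.
  rewrite nth_uniq ?sjs ?alt // nth_uniq ?sal ?sz // => /eqP E.
  by rewrite -(nth_index a as') -(nth_index a bs') E.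
- move=> v vs; have := vs; rewrite -index_mem ss; set i := index v s => lt.
  have := alP i; rewrite sz => /(_ lt) jn.
  have := realizes_joins (R _ j0 (alt i lt)) jn.
  rewrite nth_zip ?size_rot //=.
  have <- : v = w (nth 0 q i) by rewrite -(nth_map 0 v) ?sq // nth_index.
  have <- // : next s v = w (nth 0 (rot 1 q) i).
  rewrite -[v in LHS](nth_index v vs) next_nth_rot ?ss //.
  by rewrite -map_rot (nth_map 0) ?size_rot ?sq.
Qed.

Lemma realizes_cycle q j : uniq (map w q) -> D j = cycle_edges (map w q) ->
  realizes (cyclic_pairs q) j.
Proof.
move=> us DE e /(nthP (0, 0))[i]; rewrite size_zip size_rot minnn => lt <-.
rewrite nth_zip ?size_rot //= DE; apply/mem_cycle_edges.
exists (w (nth 0 q i)); first by rewrite map_f // mem_nth.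
congr [set _; _]; rewrite -[in RHS](nth_map 0 (w 0)) // next_nth_rot ?size_map //.
by rewrite -map_rot (nth_map 0) ?size_rot.
Qed.

Lemma realizes_canonical k j (s : seq V) : k \in [:: 4; 5] ->
  uniq s -> size s = 4 -> {subset s <= map w (iota 0 k)} -> D j = cycle_edges s ->
  exists2 c, c \in four_cycles k & realizes (cyclic_pairs c) j.
Proof.
move=> kE us ss sub DE.
pose q := map (fun v => index v (map w (iota 0 k))) s.
have lt v : v \in s -> index v (map w (iota 0 k)) < k.
  by move=> /sub; rewrite -index_mem size_map size_iota.
have sE : map w q = s.
  rewrite -map_comp -[RHS]map_id; apply/eq_in_map => v vs /=.
  rewrite -[RHS](nth_index (w 0) (sub v vs)) (nth_map 0) ?size_iota ?lt //.
  by rewrite nth_iota ?lt.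
have qk : q \in quads k.
  rewrite mem_quads size_map ss eqxx /=; apply/andP; split.
    by apply: (@map_uniq _ _ w); rewrite sE.
  by apply/allP => a /mapP[v vs ->]; exact: lt.
have [c cC /allP cq] := four_cycles_complete kE qk.
exists c => // e /cq; apply: realizes_joins.
by apply: realizes_cycle; rewrite sE.
Qed.

End SmallFamilies.

Lemma cover_cycle_edges (V : finType) (s : seq V) v : v \in s ->
  v \in cover (cycle_edges s).
Proof.
move=> vs; apply/bigcupP; exists [set v; next s v]; last by rewrite !inE eqxx.
by apply/mem_cycle_edges; exists v.
Qed.

(** An even cycle on at most five vertices has length 4, so [W] has 4 or 5 elements and [J] at least
    as many colours, enough for the exhaustive checks. *)
Lemma small_family (V : finType) (m : nat) (D : 'I_m -> {set {set V}})
    (J : {set 'I_m}) (W : {set V}) (i : 'I_m) :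
  i \in J -> #|W| <= #|J| -> #|W| <= 5 ->
  {in J, forall j, is_even_cycle (D j) /\ cover (D j) \subset W} ->
  has_rainbow_even_cycle D.
Proof.
move=> iJ WJ W5 JP.
have JC j : j \in J -> exists s,
    [/\ uniq s, size s = 4, {subset s <= W} & D j = cycle_edges s].
  move=> /JP[[[s [us s3 DE]] oE] /subsetP cov].
  have sub : {subset s <= W} by move=> v vs; apply: cov; rewrite DE cover_cycle_edges.
  exists s; split=> //; move: oE; rewrite DE card_cycle_edges // => oE.
  have := uniq_leq_size us (s2 := enum W).
  move=> /(_ _) le; have {}le : size s <= #|W|.
    by rewrite cardE; apply: le => v /sub; rewrite mem_enum.
  by move: (size s) s3 oE (leq_trans le W5) => [|[|[|[|[|[|]]]]]].
have [s0 [us0 ss0 sub0 DE0]] := JC i iJ.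
(* Listing [s0] first gives its vertices the labels 0 to 3, so [D i] realizes [outer_edges]. *)
pose ws := s0 ++ enum (W :\: [set v in s0]).
have uws : uniq ws.
  rewrite cat_uniq us0 enum_uniq andbT; apply/hasPn => v.
  by rewrite mem_enum !inE => /andP[].
have wsW : ws =i W.
  move=> v; rewrite mem_cat mem_enum !inE.
  by case: (boolP (v \in s0)) => [/sub0 ->|].
have sws : size ws = #|W| by rewrite -(card_uniqP uws); exact: eq_card.
have W4 : 4 <= #|W| by rewrite -sws size_cat ss0.
have [v0 _] : exists v, v \in W by apply/card_gt0P; lia.
pose w := nth v0 ws.
have wE : map w (iota 0 #|W|) = ws by rewrite -sws; exact: mkseq_nth.
have wI : {in iota 0 #|W| &, injective w}.
  move=> a b; rewrite !mem_iota /= -sws => la lb /eqP.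
  by rewrite nth_uniq // => /eqP.
have kE : #|W| \in [:: 4; 5] by rewrite !inE; lia.
have R0 : realizes D w outer_edges i.
  have wq : map w [:: 0; 1; 2; 3] = s0.
    rewrite /w /ws; move: (enum _) => rest.
    by case: (s0) ss0 => [|a [|b [|c [|d [|]]]]].
  by apply: (@realizes_cycle _ _ D w [:: 0; 1; 2; 3]); rewrite wq.
have RJ j : j \in J ->
    exists2 c, c \in four_cycles #|W| & realizes D w (cyclic_pairs c) j.
  move=> /JC[s [us ss sub DE]]; apply: realizes_canonical kE us ss _ DE.
  by move=> v /sub; rewrite wE wsW.
have filterS : {subset four_cycles #|W| <= quads #|W|}.
  by move=> q; rewrite mem_filter => /andP[].
have [js [ujs sjs jsJ]] :
    exists js, [/\ uniq (i :: js), size js = #|J|.-1 & {subset js <= J}].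
  exists (enum (J :\ i)); rewrite /= enum_uniq mem_enum !inE eqxx /=; split=> //.
    by rewrite -cardE (cardsD1 i J) iJ.
  by move=> j; rewrite mem_enum !inE => /andP[].
have lt_js a : a < #|W|.-1 -> a < size js by rewrite sjs; lia.
have R j : j \in js -> exists2 es, es \in map (@cyclic_pairs nat) (four_cycles #|W|)
                       & realizes D w es j.
  move=> /jsJ/RJ[c cC Rc]; exists (cyclic_pairs c) => //; exact: map_f.
move: kE; rewrite !inE => /orP[] /eqP kE; rewrite kE in wI filterS lt_js R.
- case: js ujs {sjs jsJ} lt_js R => [|j1 [|j2 [|j3 js]]] ujs lt_js R;
    try by have := lt_js 2 isT.
  have [|a aC Ra] := R j1; first by rewrite !inE eqxx.
  have [|b bC Rb] := R j2; first by rewrite !inE eqxx ?orbT.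
  have [|c cC Rc] := R j3; first by rewrite !inE eqxx ?orbT.
  have := allP (allP (allP rainbow_four_cycle4 a aC) b bC) c cC.
  apply: (@rainbow_of_realized _ _ D w 4 _ _ [:: i; j1; j2; j3]) => //.
    exact: subseq_uniq (prefix_subseq [:: i; j1; j2; j3] js) ujs.
  by case=> [|[|[|[|]]]].
- case: js ujs {sjs jsJ} lt_js R => [|j1 [|j2 [|j3 [|j4 js]]]] ujs lt_js R;
    try by have := lt_js 3 isT.
  have [|a aC Ra] := R j1; first by rewrite !inE eqxx.
  have [|b bC Rb] := R j2; first by rewrite !inE eqxx ?orbT.
  have [|c cC Rc] := R j3; first by rewrite !inE eqxx ?orbT.
  have [|d dC Rd] := R j4; first by rewrite !inE eqxx ?orbT.
  have u5 := subseq_uniq (prefix_subseq [:: i; j1; j2; j3; j4] js) ujs.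
  have /orP[|/allP/(_ d dC)] := allP (allP (allP rainbow_four_cycle5 a aC) b bC) c cC.
    apply: (@rainbow_of_realized _ _ D w 5 _ _ [:: i; j1; j2; j3]) => //.
      exact: subseq_uniq (prefix_subseq [:: i; j1; j2; j3] [:: j4]) u5.
    by case=> [|[|[|[|]]]].
  apply: (@rainbow_of_realized _ _ D w 5 _ _ [:: i; j1; j2; j3; j4]) => //.
  by case=> [|[|[|[|[|]]]]].
Qed.

(** * Sizes of reachable sets and of forests *)

Section Counting.
Variables (V : finType) (m : nat) (D : 'I_m -> {set {set V}}).
Hypothesis D_even : forall i, is_even_cycle (D i).
Hypothesis no_rainbow : ~ has_rainbow_even_cycle D.

(** The forest edges of reachable colours connect all reachable cycles. Along an exchange path, [y]
    is constant on each cycle, and the edge [g] behind an arc to [j] links the preceding cycle to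
    [t j]. *)
Lemma reach_connected K t x i j r v (y : V -> bool) : max_rainbow_forest D K t x ->
  i \notin K -> {in reach D K x i :\ i, forall l, ~~ crosses y (t l)} ->
  r \in cover (D i) -> j \in reach D K x i -> v \in cover (D j) -> y v = y r.
Proof.
move=> mF iK y0 ri jR; have := jR; rewrite inE => /connectP[p pp jE].
have [tD dual] := mF.1.
have cyc k : is_cycle (D k) by case: (D_even k).
have yD k : k \in reach D K x i -> {in D k, forall h, ~~ crosses y h}.
  by move=> kR h hD; exact: reach_spanned mF iK kR hD y y0.
elim/last_ind: p j jR pp jE v => [|p b IH] j jR pp jE v.
  move=> vD; rewrite jE /= in vD jR.
  exact: cycle_connected (cyc i) (yD i jR) vD ri.
move: jE pp; rewrite last_rcons rcons_path => jE /andP[pp]; rewrite -jE {b jE}.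
set a := last i p => /andP[jK /existsP[g /andP[gD jg]]].
have aR : a \in reach D K x i by rewrite inE; apply/connectP; exists p.
have {}IH u : u \in g -> y u = y r.
  by move=> ug; apply: (IH a) => //; apply/bigcupP; exists g.
have [u0 [u1 [u01 tE]]] := cycle_edge_pair (cyc j) (tD j jK).
suff yu0 : y u0 = y r.
  move=> vD; rewrite -yu0; apply: cycle_connected (cyc j) (yD j jR) vD _.
  by apply/bigcupP; exists (t j); rewrite ?tD // tE !inE eqxx.
apply/eqP/negPn/negP => yu0.
have jR' : j \in reach D K x i :\ i.
  by rewrite in_setD1 jR andbT; apply: contraNneq iK => <-.
(* The cut of [t j] restricted to the side of [r] misses the whole tree. *)
pose z u := (y u == y r) && x j u.
have z0 : {in reach D K x i :\ i, forall l, ~~ crosses z (t l)}.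
  move=> l lR; have lK : l \in K.
    by have := lR; rewrite in_setD1 => /andP[li lR']; exact: reach_used lR' li.
  have [a0 [a1 [a01 tlE]]] := cycle_edge_pair (cyc l) (tD l lK).
  have := y0 l lR; rewrite tlE !crosses_pair // negb_add => /eqP ya.
  have [yr|nyr] := eqVneq (y a0) (y r); last by rewrite /z -ya (negbTE nyr).
  rewrite /z -ya yr eqxx !andTb.
  have := dual j l jK lK; rewrite tlE crosses_pair // => ->.
  apply: contraNneq yu0 => jl; rewrite -jl tE in tlE.
  have : u0 \in [set a0; a1] by rewrite -tlE !inE eqxx.
  by case/set2P=> ->; rewrite -?ya yr.
have := reach_spanned mF iK aR gD z0.
rewrite (@eq_crosses _ z (x j)) ?jg // => u /IH yu.
by rewrite /z yu eqxx.
Qed.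

(** Replaces a comparison of dimensions over F_2 by one of powers of 2. *)
Lemma card_powerset_inj (A B : finType) (S : {set A}) (S' : {set B})
    (F : {set A} -> {set B}) :
  {in powerset S &, injective F} -> {in powerset S, forall X, F X \subset S'} ->
  #|S| <= #|S'|.
Proof.
move=> FI FS; rewrite -(leq_exp2l _ _ (isT : 1 < 2)) -!card_powerset.
rewrite -(card_in_imset FI); apply/subset_leq_card/subsetP => Y /imsetP[X XS ->].
by rewrite inE FS.
Qed.

Lemma card_reach K t x i : max_rainbow_forest D K t x -> i \notin K ->
  5 < #|reach D K x i|.
Proof.
move=> mF iK; rewrite ltnNge; apply/negP => J5; apply: no_rainbow.
set J := reach D K x i in J5.
have iJ : i \in J by rewrite inE connect0.
have [r ri] : exists r, r \in cover (D i).
  have [[s [us s3 ->]] _] := D_even i.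
  case: s s3 {us} => [//|r s] _; exists r; exact: cover_cycle_edges (mem_head _ _).
pose W := r |: \bigcup_(j in J) cover (D j).
have WP (y : V -> bool) v : {in J :\ i, forall l, ~~ crosses y (t l)} ->
    v \in W -> y v = y r.
  move=> y0; rewrite 2!inE => /predU1P[->//|/bigcupP[j jJ vD]].
  exact: reach_connected mF iK y0 ri jJ vD.
(* A subset of [W] avoiding [r] is determined by the forest edges of [J :\ i] that cross it: the
   difference of two subsets with equal crossings is constant on [W] and vanishes at [r]. *)
have WJ : #|W| <= #|J|.
  rewrite (cardsD1 r W) (cardsD1 i J) iJ 2!inE eqxx !add1n ltnS.
  pose F (X : {set V}) := [set l in J :\ i | crosses (mem X) (t l)].
  apply: (@card_powerset_inj _ _ _ _ F); last first.
    by move=> X _; apply/subsetP => l; rewrite inE => /andP[].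
  move=> X Y; rewrite !inE => XW YW FXY; apply/setP => v.
  have y0 : {in J :\ i, forall l,
      ~~ crosses (fun v => (v \in X) (+) (v \in Y)) (t l)}.
    move=> l lJ; rewrite crosses_add.
    have FE (Z : {set V}) : crosses (mem Z) (t l) = (l \in F Z) by rewrite in_set lJ.
    by rewrite !FE FXY addbb.
  have nr (Z : {set V}) : Z \subset W :\ r -> r \notin Z.
    by move=> /subsetP sub; apply/negP => /sub; rewrite !inE eqxx.
  have [vW|vW] := boolP (v \in W).
    have := WP _ v y0 vW; rewrite /= (negbTE (nr X XW)) (negbTE (nr Y YW)).
    by case: (v \in X); case: (v \in Y).
  have nv (Z : {set V}) : Z \subset W :\ r -> v \in Z = false.
    move=> /subsetP sub; apply/negP => /sub.
    by rewrite in_setD1 (negbTE vW) andbF.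
  by rewrite !nv.
apply: (small_family iJ WJ (leq_trans WJ J5)) => j jJ; split=> //.
apply/subsetP => v vD; rewrite 2!inE; apply/orP; right.
by apply/bigcupP; exists j.
Qed.

(** Sums of dual cuts, normalised to vanish at [r], are distinct for distinct [S], since crossing
    with the forest edges recovers [S]. *)
Lemma card_rainbow_forest K t x (r : V) : rainbow_forest D K t x -> #|K| <= #|V|.-1.
Proof.
move=> [tD dual].
have -> : #|V|.-1 = #|[set~ r]| by rewrite cardsC1.
pose Y (S : {set 'I_m}) v := \big[addb/false]_(l in S) x l v.
pose F (S : {set 'I_m}) := [set v | Y S v (+) Y S r].
apply: (@card_powerset_inj _ _ _ _ F); last first.
  move=> S _; apply/subsetP => v; rewrite !inE; apply: contraTneq => ->.
  by rewrite addbb.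
move=> S S'; rewrite !inE => /subsetP SK /subsetP SK' FE.
have YE (Z : {set 'I_m}) l :
    {subset Z <= K} -> l \in K -> crosses (Y Z) (t l) = (l \in Z).
  move=> ZK lK; rewrite /Y crosses_sum.
  rewrite (eq_bigr (fun j => j == l)); last by move=> j /ZK jK; exact: dual.
  have [lZ|lZ] := boolP (l \in Z).
    rewrite (bigD1 l) //= eqxx big1 // => j /andP[_ jl].
    exact/negbTE.
  by rewrite big1 // => j jZ; apply/negbTE; apply: contraNneq lZ => <-.
have FC (Z : {set 'I_m}) l : l \in K -> crosses (Y Z) (t l) = crosses (mem (F Z)) (t l).
  move=> lK; have [c _] := D_even l.
  have [u0 [u1 [u01 ->]]] := cycle_edge_pair c (tD l lK).
  rewrite !crosses_pair // !inE /=.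
  by case: (Y Z u0); case: (Y Z u1); case: (Y Z r).
apply/setP => l; have [lK|lK] := boolP (l \in K).
  by rewrite -YE // -[RHS]YE // !FC // FE.
by rewrite (negbTE (contra (SK l) lK)) (negbTE (contra (SK' l) lK)).
Qed.

(** Without a maximum, forests would grow beyond [m] colours. *)
Lemma max_rainbow_forest_exists : exists K t x, max_rainbow_forest D K t x.
Proof.
apply: NNPP => none.
have grow k : exists K t x, rainbow_forest D K t x /\ k <= #|K|.
  elim: k => [|k [K [t [x [RF kK]]]]].
    exists set0, (fun=> set0), (fun _ _ => false); split=> //.
    by split=> j; rewrite inE.
  apply: NNPP => no; apply: none; exists K, t, x; split=> // K' t' x' RF'.
  rewrite leqNgt; apply/negP => lt; apply: no; exists K', t', x'; split=> //.
  exact: leq_trans lt.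
have [K [t [x [_]]]] := grow m.+1.
by rewrite ltnNge -[X in _ <= X]card_ord max_card.
Qed.

Lemma few_colors (r : V) : 5 * m <= 6 * #|V|.-1.
Proof.
have [K [t [x mF]]] := max_rainbow_forest_exists.
have KV := card_rainbow_forest r mF.1.
have : 6 * #|~: K| <= m.
  pose P := [set reach D K x i | i in ~: K].
  have reachI : {in ~: K &, injective (reach D K x)}.
    move=> i k; rewrite !inE => iK kK E; apply/eqP/negPn/negP => ik.
    have := reach_disjoint D_even no_rainbow mF iK kK ik.
    rewrite -E -setI_eq0 setIid => /eqP E0.
    by have := card_reach mF iK; rewrite E0 cards0.
  have tP : trivIset P.
    apply/trivIsetP => _ _ /imsetP[i iK ->] /imsetP[k kK ->] ne.
    rewrite !inE in iK kK; apply: (reach_disjoint D_even no_rainbow mF) => //.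
    by apply: contraNneq ne => ->.
  have := max_card (mem (cover P)); rewrite card_ord; apply: leq_trans.
  move: tP; rewrite /trivIset => /eqP <-.
  rewrite big_imset //= mulnC -sum_nat_const; apply: leq_sum => i.
  by rewrite inE => iK; exact: card_reach mF iK.
(* [6 * (m - #|K|) <= m] gives [5 * m <= 6 * #|K|], and [#|K|] is at most [#|V|.-1]. *)
have := cardsC K; rewrite card_ord; lia.
Qed.

End Counting.

Theorem theorem1p2 (n : nat) (hn : 0 < n)
    (D : 'I_((6 * (n - 1)) %/ 5 + 1) -> {set {set 'I_n}}) :
  (forall i, is_even_cycle (D i)) -> has_rainbow_even_cycle D.
Proof.
move=> D_even; apply: NNPP => no_rainbow.
(* The bound [5 * m <= 6 * (n - 1)] fails for [m] one above the floor of [6 * (n - 1) / 5]. *)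
have := few_colors D_even no_rainbow (Ordinal hn).
rewrite card_ord; lia.
Qed.
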